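(* Let $\mathcal{A}$ be a unital Banach algebra, let $I$ and $J$ be arbitrary index sets, and let $P$ be a $J\times I$ matrix over $\mathcal{A}$ such that all of its non-zero entries are invertible and $\|P\|_\infty=\sup\{\|P_{ji}\|: j\in J, i\in I\}\le 1$. If $\mathcal{A}$ is bounded $\omega^*$-approximately cyclic amenable, then so is the $\ell^1$-Munn algebra $LM(\mathcal{A},P)$.
   Context: $LM(\mathcal{A},P)$ is the Banach space $\ell^1(I\times J,\mathcal{A})$ of all $I\times J$ matrices $X$ over $\mathcal{A}$ with $\|X\|_1=\sum_{i,j}\|X_{ij}\|<\infty$, made into a Banach algebra by the product $X\circ Y=XPY$. For a Banach algebra $\mathcal{C}$, the dual $\mathcal{C}^*$ is a Banach $\mathcal{C}$-bimodule via $\langle a\cdot f,b\rangle=\langle f,ba\rangle$, $\langle f\cdot a,b\rangle=\langle f,ab\rangle$; for $x\in\mathcal{C}^*$, $\mathrm{ad}_x:\mathcal{C}\to\mathcal{C}^*$ is $\mathrm{ad}_x(a)=a\cdot x-x\cdot a$. A derivation $D:\mathcal{C}\to\mathcal{C}^*$ is a bounded linear map with $D(ab)=D(a)\cdot b+a\cdot D(b)$; it is cyclic if $\langle D(a),b\rangle+\langle D(b),a\rangle=0$ for all $a,b\in\mathcal{C}$. $\mathcal{C}$ is bounded $\omega^*$-approximately cyclic amenable if for every cyclic continuous derivation $D:\mathcal{C}\to\mathcal{C}^*$ there is a net $(x_\alpha)$ in $\mathcal{C}^*$ such that the net $(\mathrm{ad}_{x_\alpha})$ is norm bounded in $B(\mathcal{C},\mathcal{C}^*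 )$, the space of bounded linear maps from $\mathcal{C}$ to $\mathcal{C}^*$, and $D(a)=\omega^*\text{-}\lim_\alpha \mathrm{ad}_{x_\alpha}(a)$ (weak-* limit in $\mathcal{C}^*$) for all $a\in\mathcal{C}$.
   Formalization: The matrix P is additionally assumed to be non-zero; for P = 0 the claim is false, e.g. A = C, |I| = 2, |J| = 1, where LM(A,P) is C^2 with zero product and has a non-zero cyclic derivation while every ad_x vanishes. *)

(* Defs.v *)
From HB Require Import structures.
From mathcomp Require Import all_boot all_order all_algebra finmap.
From mathcomp Require Import all_classical reals ereal topology normedtype esum.
From mathcomp.analysis.showcase Require summability.
From mathcomp.real_closed Require Import complex.

Set Implicit Arguments.
Unset Strict Implicit.
Unset Printing Implicit Defensive.

Import Order.TTheory GRing.Theory Num.Theory.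
Import numFieldNormedType.Exports.

Local Open Scope classical_set_scope.
Local Open Scope ring_scope.
Local Open Scope complex_scope.

Section rnorm.
Context {R : realType} {V : normedModType R[i]}.
Implicit Types x y : V.

(* In a normed module over [R[i]] the norm is [R[i]]-valued; [rnorm] is the
   same nonnegative number seen in [R]. *)
Definition rnorm x : R := complex.Re `|x|.

Lemma rnormE x : `|x| = (rnorm x)%:C.
Proof. by rewrite /rnorm RRe_real ?normr_real. Qed.

Lemma lecR (a b : R) : (a%:C <= b%:C) = (a <= b).
Proof. by rewrite lecE/= eqxx. Qed.

Lemma ltcR (a b : R) : (a%:C < b%:C) = (a < b).
Proof. by rewrite ltcE/= eqxx. Qed.

Lemma real_complex_inj : injective (fun a : R => a%:C).
Proof. by move=> a b []. Qed.

Lemma rnorm_ge0 x : 0 <= rnorm x.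
Proof. by rewrite -lecR -rnormE; exact: normr_ge0. Qed.

Lemma rnorm_le x (a : R) : (rnorm x <= a) = (`|x| <= a%:C).
Proof. by rewrite rnormE lecR. Qed.

Lemma rnormD x y : rnorm (x + y) <= rnorm x + rnorm y.
Proof. by rewrite rnorm_le rmorphD/= -!rnormE ler_normD. Qed.

Lemma rnormB x y : rnorm (x - y) = rnorm (y - x).
Proof. by rewrite /rnorm distrC. Qed.

Lemma rnorm0 : rnorm (0 : V) = 0.
Proof. by rewrite /rnorm normr0. Qed.

Lemma rnorm0_eq0 x : rnorm x = 0 -> x = 0.
Proof. by move=> x0; apply/normr0_eq0; rewrite rnormE x0. Qed.

Lemma rnormZ (k : R[i]) x : rnorm (k *: x) = complex.Re `|k| * rnorm x.
Proof.
apply: real_complex_inj.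
have -> : (complex.Re `|k| * rnorm x)%:C = (complex.Re `|k|)%:C * (rnorm x)%:C.
  exact: (rmorphM (real_complex R)).
by rewrite -!rnormE normrZ RRe_real ?normr_real.
Qed.

End rnorm.


Section bounded_operators.
Context {R : realType} (V W : normedModType R[i]).

Definition bounded_op_pred : {pred V -> W} :=
  [pred f | `[< linear f /\ continuous f >]].

(* [B(V, W)]: on linear maps, continuity and boundedness coincide. *)
Record bounded_op := BoundedOp {
  bounded_op_fun :> V -> W ;
  _ : bounded_op_fun \in bounded_op_pred
}.

HB.instance Definition _ := [isSub for bounded_op_fun].
HB.instance Definition _ := [Choice of bounded_op by <:].

Lemma bounded_op_submod_closed : submod_closed bounded_op_pred.
Proof.
split.
  rewrite inE; split; first by move=> k x y; rewrite scaler0 addr0.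
  by move=> x; exact: cvg_cst.
move=> k f g; rewrite !inE => -[lf cf] [lg cg]; split.
  move=> a x y /=; rewrite !fctE lf lg !scalerDr !scalerA [k * a]mulrC.
  by rewrite addrACA.
by move=> x; apply: cvgD; [apply: cvgZr; exact: cf|exact: cg].
Qed.

HB.instance Definition _ :=
  GRing.isSubmodClosed.Build _ _ bounded_op_pred bounded_op_submod_closed.
HB.instance Definition _ := [SubChoice_isSubLmodule of bounded_op by <:].

Implicit Types f g : bounded_op.

Lemma bounded_op_linear f : linear f.
Proof. by case: f => f /=; rewrite inE => -[]. Qed.

HB.instance Definition _ f := GRing.isLinear.Build _ _ _ _ f (bounded_op_linear f).

Lemma bounded_op_continuous f : continuous f.
Proof. by case: f => f /=; rewrite inE => -[]. Qed.

Lemma bounded_opP f g : f =1 g -> f = g.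
Proof. by move=> fg; apply/val_inj/funext. Qed.

Lemma bounded_opDE f g x : (f + g) x = f x + g x.
Proof. by []. Qed.

Lemma bounded_opNE f x : (- f) x = - f x.
Proof. by []. Qed.

Lemma bounded_opZE k f x : (k *: f) x = k *: f x.
Proof. by []. Qed.

Definition opnorm f : R := sup [set rnorm (f x) | x in [set x | rnorm x <= 1]].

End bounded_operators.

Section opnorm.
Context {R : realType} (V W : normedModType R[i]).
Implicit Types f g : bounded_op V W.

Lemma bounded_op_bound f :
  exists2 M : R, 0 <= M & forall x, rnorm (f x) <= M * rnorm x.
Proof.
have /linear_bounded_continuous/linear_boundedP := @bounded_op_continuous _ _ _ f.
move=> /pinfty_ex_gt0[r r0 fr].
have rE : r = (complex.Re r)%:C by rewrite RRe_real// ger0_real// ltW.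
exists (complex.Re r); first by rewrite -lecR -rE ltW.
move=> x; rewrite rnorm_le (le_trans (fr x))//.
by rewrite [in leLHS]rE [in leLHS]rnormE (rmorphM (real_complex R)).
Qed.

Let S f := [set rnorm (f x) | x in [set x | rnorm x <= 1]].

Let has_sup_S f : has_sup (S f).
Proof.
split; first by exists (rnorm (f 0)), 0 => //=; rewrite rnorm0.
have [M M0 fM] := bounded_op_bound f.
exists M => _ [x /= x1 <-]; rewrite (le_trans (fM x))//.
by rewrite -[leRHS]mulr1 ler_wpM2l.
Qed.

Lemma opnorm_ge0 f : 0 <= opnorm f.
Proof.
apply: (le_trans (rnorm_ge0 (f 0))); apply: ub_le_sup.
  by have [] := has_sup_S f.
by exists 0 => //=; rewrite rnorm0.
Qed.

Lemma opnorm_bound f x : rnorm (f x) <= opnorm f * rnorm x.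
Proof.
have [->|x0] := eqVneq x 0; first by rewrite linear0 !rnorm0 mulr0.
have nx0 : 0 < rnorm x.
  by rewrite lt_def rnorm_ge0 andbT; apply: contraNneq x0 => /rnorm0_eq0 ->.
have nE (k : R) : 0 <= k -> complex.Re `|k%:C| = k.
  by move=> k0; rewrite normc_def/= expr0n addr0 sqrtr_sqr ger0_norm.
rewrite -ler_pdivrMr// mulrC; apply: ub_le_sup.
  by have [] := has_sup_S f.
exists ((rnorm x)^-1%:C *: x) => /=.
  by rewrite rnormZ nE ?invr_ge0 ?rnorm_ge0// mulVf// gt_eqF.
by rewrite linearZ/= rnormZ nE ?invr_ge0 ?rnorm_ge0.
Qed.

Lemma opnorm_le f (M : R) :
  0 <= M -> (forall x, rnorm (f x) <= M * rnorm x) -> opnorm f <= M.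
Proof.
move=> M0 fM; apply: ge_sup; first by have [] := has_sup_S f.
move=> _ [x /= x1 <-]; rewrite (le_trans (fM x))//.
by rewrite -[leRHS]mulr1 ler_wpM2l.
Qed.

Let norm f : R[i] := (opnorm f)%:C.

Let normD f g : norm (f + g) <= norm f + norm g.
Proof.
rewrite /norm -(rmorphD (real_complex R)) lecR. apply: opnorm_le.
  by rewrite addr_ge0 ?opnorm_ge0.
move=> x; rewrite mulrDl (le_trans (rnormD _ _))//.
by rewrite lerD ?opnorm_bound.
Qed.

Let norm_eq0 f : norm f = 0 -> f = 0.
Proof.
move=> /real_complex_inj f0; apply/bounded_opP => x; apply/rnorm0_eq0/le_anti.
by rewrite rnorm_ge0 andbT (le_trans (opnorm_bound f x))// f0 mul0r.
Qed.

Let normZ (k : R[i]) f : norm (k *: f) = `|k| * norm f.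
Proof.
have le (c : R[i]) (h : bounded_op V W) : opnorm (c *: h) <= complex.Re `|c| * opnorm h.
  have c0 : 0 <= complex.Re `|c| by apply: (@rnorm_ge0 R R[i]^o).
  apply: opnorm_le; first by rewrite mulr_ge0 ?opnorm_ge0.
  by move=> x; rewrite rnormZ -mulrA ler_wpM2l ?opnorm_bound.
have kE : `|k| = (complex.Re `|k|)%:C by rewrite RRe_real ?normr_real.
rewrite /norm kE -(rmorphM (real_complex R)); congr (_%:C); apply/le_anti.
rewrite le andTb; have [->|k0] := eqVneq k 0.
  by rewrite normr0 mul0r opnorm_ge0.
have nk0 : 0 < complex.Re `|k| by rewrite -ltcR -kE normr_gt0.
rewrite mulrC -ler_pdivlMr//.
rewrite -[in leLHS](scale1r f) -(mulVf k0) -scalerA (le_trans (le _ _))// mulrC.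
rewrite ler_wpM2l ?opnorm_ge0//.
suff -> : complex.Re `|k^-1| = (complex.Re `|k|)^-1 by [].
apply: real_complex_inj.
have -> : (complex.Re `|k|)^-1%:C = (complex.Re `|k|)%:C^-1.
  exact: (fmorphV (real_complex R)).
by rewrite -kE -normfV RRe_real ?normr_real.
Qed.

HB.instance Definition _ :=
  Lmodule_isNormed.Build R[i] (bounded_op V W) normD normZ norm_eq0.

Lemma rnorm_opnorm f : rnorm f = opnorm f.
Proof. by []. Qed.

End opnorm.

Section make_bounded_op.
Context {R : realType} {V W : normedModType R[i]} (f : V -> W) (M : R).
Hypothesis lf : linear f.
Hypothesis fM : forall x, rnorm (f x) <= M * rnorm x.

Let f_pred : f \in @bounded_op_pred R V W.
Proof.
rewrite inE; split => //.
pose fL : {linear V -> W} := HB.pack f (GRing.isLinear.Build _ _ _ _ f lf).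
apply: (@bounded_linear_continuous _ _ _ fL); apply/linear_boundedP.
exists M%:C; split; first by rewrite complex_real.
move=> r Mr x; rewrite (@le_trans _ _ (M%:C * `|x|))//.
  by rewrite rnormE [in leRHS]rnormE -(rmorphM (real_complex R)) lecR.
by rewrite ler_wpM2r// ltW.
Qed.

Definition make_bounded_op : bounded_op V W := BoundedOp f_pred.

End make_bounded_op.

(* Banach algebras without unit: the algebra structures of the library are all
   unital, so the product has to be added to complete normed modules. *)
HB.mixin Record CompleteNormedModule_isBanachAlgebra (K : numFieldType) V
    & CompleteNormedModule K V := {
  bmul : V -> V -> V ;
  bmulA : associative bmul ;
  bmulDl : left_distributive bmul +%R ;
  bmulDr : right_distributive bmul +%R ;
  bmulZl : forall (k : K) (x y : V), bmul (k *: x) y = k *: bmul x y ;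
  bmulZr : forall (k : K) (x y : V), bmul x (k *: y) = k *: bmul x y ;
  ler_norm_bmul : forall x y : V, `|bmul x y| <= `|x| * `|y|
}.

#[short(type="banachAlgType")]
HB.structure Definition BanachAlgebra (K : numFieldType) :=
  {V of CompleteNormedModule K V & CompleteNormedModule_isBanachAlgebra K V}.

HB.mixin Record BanachAlgebra_hasOne (K : numFieldType) A
    & BanachAlgebra K A := {
  bone : A ;
  bmul1l : left_id bone (@bmul K A) ;
  bmul1r : right_id bone (@bmul K A)
}.

#[short(type="unitalBanachAlgType")]
HB.structure Definition UnitalBanachAlgebra (K : numFieldType) :=
  {A of BanachAlgebra K A & BanachAlgebra_hasOne K A}.

Definition binvertible {K : numFieldType} {A : unitalBanachAlgType K} (a : A) :=
  exists b : A, bmul a b = bone /\ bmul b a = bone.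

Definition dual {R : realType} (V : normedModType R[i]) := bounded_op V R[i]^o.

Section dual_bimodule.
Context {R : realType} {B : banachAlgType R[i]}.
Implicit Types (a b c : B) (f x : dual B).

Lemma rnorm_bmul a b : rnorm (bmul a b) <= rnorm a * rnorm b.
Proof.
rewrite rnorm_le (le_trans (ler_norm_bmul _ _))//.
by rewrite rnormE [in leLHS]rnormE -(rmorphM (real_complex R)).
Qed.

Let lact_linear a f : linear (fun b => f (bmul b a) : R[i]^o).
Proof. by move=> k b c; rewrite bmulDl bmulZl linearP. Qed.

Let lact_bound a f b : rnorm (f (bmul b a)) <= (opnorm f * rnorm a) * rnorm b.
Proof.
rewrite (le_trans (opnorm_bound _ _))// -mulrA ler_wpM2l ?opnorm_ge0//.
by rewrite [leRHS]mulrC rnorm_bmul.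
Qed.

(* <a . f, b> = <f, ba> and <f . a, b> = <f, ab> *)
Definition lact a f : dual B := make_bounded_op (lact_linear a f) (lact_bound a f).

Let ract_linear f a : linear (fun b => f (bmul a b) : R[i]^o).
Proof. by move=> k b c; rewrite bmulDr bmulZr linearP. Qed.

Let ract_bound f a b : rnorm (f (bmul a b)) <= (opnorm f * rnorm a) * rnorm b.
Proof.
by rewrite (le_trans (opnorm_bound _ _))// -mulrA ler_wpM2l ?opnorm_ge0 ?rnorm_bmul.
Qed.

Definition ract f a : dual B := make_bounded_op (ract_linear f a) (ract_bound f a).

Let ad_linear x : linear (fun a => lact a x - ract x a).
Proof.
move=> k a b; apply/bounded_opP => c.
rewrite !(bounded_opDE, bounded_opNE, bounded_opZE)/=.
rewrite bmulDl bmulDr bmulZl bmulZr !linearP/=.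
by rewrite scalerBr scalerN addrACA.
Qed.

Let ad_bound x a : rnorm (lact a x - ract x a) <= (opnorm x *+ 2) * rnorm a.
Proof.
rewrite (le_trans (rnormD _ _))// mulr2n mulrDl lerD//.
  apply: opnorm_le; first by rewrite mulr_ge0 ?opnorm_ge0 ?rnorm_ge0.
  exact: lact_bound.
rewrite /rnorm normrN.
apply: opnorm_le; first by rewrite mulr_ge0 ?opnorm_ge0 ?rnorm_ge0.
exact: ract_bound.
Qed.

Definition ad x : bounded_op B (dual B) := make_bounded_op (ad_linear x) (ad_bound x).

Definition is_derivation (D : bounded_op B (dual B)) : Prop :=
  forall a b, D (bmul a b) = ract (D a) b + lact a (D b).

Definition is_cyclic (D : bounded_op B (dual B)) : Prop :=
  forall a b, D a b + D b a = 0.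

End dual_bimodule.

Section nets.
Context {L : Type} (le : L -> L -> Prop).

Definition directed : Prop :=
  [/\ inhabited L, forall a, le a a, forall a b c, le a b -> le b c -> le a c
    & forall a b, exists c, le a c /\ le b c].

(* Convergence along this filter is convergence of nets indexed by [L]. *)
Definition tails : set_system L := filter_from setT (fun a => [set b | le a b]).

Lemma tails_filter : directed -> ProperFilter tails.
Proof.
move=> [[a0] lexx le_trans dir]; apply: filter_from_proper.
  apply: filter_fromT_filter; first by exists a0.
  move=> a b; have [c [ac bc]] := dir a b.
  by exists c => d /= cd; split; apply: le_trans cd.
by move=> a _; exists a.
Qed.

End nets.

Definition wstar_cvg {R : realType} {V : normedModType R[i]} {L : Type}
    (le : L -> L -> Prop) (f : L -> dual V) (g : dual V) : Prop :=
  forall v : V, (fun l => f l v) @ tails le --> g v.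

Definition bounded_wstar_approx_cyclic_amenable {R : realType}
    (B : banachAlgType R[i]) : Prop :=
  forall D : bounded_op B (dual B), is_derivation D -> is_cyclic D ->
  exists (L : Type) (le : L -> L -> Prop) (x : L -> dual B),
    [/\ directed le,
        exists M : R, forall l, opnorm (ad (x l)) <= M
      & forall a, wstar_cvg le (fun l => ad (x l) a) (D a)].

Section ell1.
Context {R : realType} (T : choiceType) (V : completeNormedModType R[i]).
Implicit Types (f g : T -> V) (A B : {fset T}).

Definition l1norm f : \bar R := (\esum_(t in [set: T]) (rnorm (f t))%:E)%E.

Lemma l1norm_ge0 f : (0 <= l1norm f)%E.
Proof. by apply: esum_ge0 => t _; rewrite lee_fin rnorm_ge0. Qed.

Lemma l1norm_leP f (M : R) :
  (l1norm f <= M%:E)%E <-> forall A, \sum_(t <- A) rnorm (f t) <= M.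
Proof.
split=> [fM A|fM].
  rewrite -lee_fin (le_trans _ fM)// -sumEFin; apply: ereal_sup_ubound.
  exists [set` A]; first by split.
  by rewrite fsbig_finite//= set_fsetK.
apply: ge_ereal_sup => _ [X [Xfin _] <-].
by rewrite fsbig_finite//= sumEFin lee_fin.
Qed.

Definition ell1_pred : {pred T -> V} := [pred f | (l1norm f < +oo)%E].

Record ell1 := Ell1 { ell1_fun :> T -> V ; _ : ell1_fun \in ell1_pred }.

HB.instance Definition _ := [isSub for ell1_fun].
HB.instance Definition _ := [Choice of ell1 by <:].

Lemma ell1_predP f :
  f \in ell1_pred <-> exists M, forall A, \sum_(t <- A) rnorm (f t) <= M.
Proof.
split=> [fl|[M /l1norm_leP fM]]; last by rewrite inE (le_lt_trans fM)// ltry.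
exists (fine (l1norm f)); apply/l1norm_leP; rewrite fineK// ge0_fin_numE//.
exact: l1norm_ge0.
Qed.

Lemma ell1_submod_closed : submod_closed ell1_pred.
Proof.
split; first by apply/ell1_predP; exists 0 => A; rewrite big1// => t _; rewrite rnorm0.
move=> k f g /ell1_predP[M fM] /ell1_predP[N gN]; apply/ell1_predP.
exists (complex.Re `|k| * M + N) => A.
apply: (@le_trans _ _ (\sum_(t <- A) (complex.Re `|k| * rnorm (f t) + rnorm (g t)))).
  by apply: ler_sum => t _; rewrite -rnormZ; exact: rnormD.
by rewrite big_split/= -mulr_sumr lerD// ler_wpM2l// (@rnorm_ge0 R R[i]^o).
Qed.

HB.instance Definition _ :=
  GRing.isSubmodClosed.Build _ _ ell1_pred ell1_submod_closed.
HB.instance Definition _ := [SubChoice_isSubLmodule of ell1 by <:].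

Implicit Types x y : ell1.

Lemma ell1P x y : x =1 y -> x = y.
Proof. by move=> xy; apply/val_inj/funext. Qed.

Lemma ell1DE x y t : (x + y) t = x t + y t. Proof. by []. Qed.
Lemma ell1NE x t : (- x) t = - x t. Proof. by []. Qed.
Lemma ell1ZE k x t : (k *: x) t = k *: x t. Proof. by []. Qed.
Lemma ell10E t : (0 : ell1) t = 0. Proof. by []. Qed.

Definition ell1_norm x : R := fine (l1norm x).

Lemma ell1_normE x : (ell1_norm x)%:E = l1norm x.
Proof.
rewrite fineK// ge0_fin_numE ?l1norm_ge0//.
by case: x => x /= xP; move: xP; rewrite inE.
Qed.

Lemma ell1_norm_leP x (M : R) :
  ell1_norm x <= M <-> forall A, \sum_(t <- A) rnorm (x t) <= M.
Proof. by rewrite -lee_fin ell1_normE; exact: l1norm_leP. Qed.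

Lemma le_ell1_norm x A : \sum_(t <- A) rnorm (x t) <= ell1_norm x.
Proof. by move: A; apply/ell1_norm_leP. Qed.

Lemma ell1_norm_ge0 x : 0 <= ell1_norm x.
Proof. by have := le_ell1_norm x fset0; rewrite big_seq_fset0. Qed.

Lemma rnorm_le_ell1 x t : rnorm (x t) <= ell1_norm x.
Proof. by have := le_ell1_norm x [fset t]%fset; rewrite big_seq_fset1. Qed.

Let norm x : R[i] := (ell1_norm x)%:C.

Let normD x y : norm (x + y) <= norm x + norm y.
Proof.
rewrite /norm -(rmorphD (real_complex R)) lecR; apply/ell1_norm_leP => A.
apply: (@le_trans _ _ (\sum_(t <- A) (rnorm (x t) + rnorm (y t)))).
  by apply: ler_sum => t _; exact: rnormD.
by rewrite big_split lerD ?le_ell1_norm.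
Qed.

Let norm_eq0 x : norm x = 0 -> x = 0.
Proof.
move=> /real_complex_inj x0; apply/ell1P => t; apply/rnorm0_eq0/le_anti.
by rewrite rnorm_ge0 andbT -x0 rnorm_le_ell1.
Qed.

Let normZ (k : R[i]) x : norm (k *: x) = `|k| * norm x.
Proof.
have kE : `|k| = (complex.Re `|k|)%:C by rewrite RRe_real ?normr_real.
rewrite /norm kE -(rmorphM (real_complex R)); congr (_%:C); apply/le_anti.
have k0 : 0 <= complex.Re `|k| by apply: (@rnorm_ge0 R R[i]^o).
apply/andP; split.
  apply/ell1_norm_leP => A; under eq_bigr do rewrite ell1ZE rnormZ.
  by rewrite -mulr_sumr ler_wpM2l// le_ell1_norm.
have [{}k0|k0'] := ltP 0 (complex.Re `|k|); last first.
  by rewrite (le_trans _ (ell1_norm_ge0 _))// mulr_le0_ge0 ?ell1_norm_ge0.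
rewrite mulrC -ler_pdivlMr//; apply/ell1_norm_leP => A.
rewrite ler_pdivlMr// mulrC mulr_sumr.
under eq_bigr do rewrite -rnormZ -ell1ZE.
exact: le_ell1_norm.
Qed.

HB.instance Definition _ :=
  Lmodule_isNormed.Build R[i] ell1 normD normZ norm_eq0.

Lemma rnorm_ell1 x : rnorm x = ell1_norm x.
Proof. by []. Qed.

End ell1.

Section gt0_complex.
Context {R : realType}.

Lemma gt0_complexE (e : R[i]) : 0 < e -> e = (complex.Re e)%:C /\ 0 < complex.Re e.
Proof.
move=> e0; have eE : e = (complex.Re e)%:C by rewrite RRe_real// gtr0_real.
by split => //; rewrite -ltcR -eE.
Qed.

End gt0_complex.

Section ell1_complete.
Context {R : realType} (T : choiceType) (V : completeNormedModType R[i]).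
Implicit Types (x y z : ell1 T V).

Lemma ball_rnorm {W : normedModType R[i]} (x y : W) (e : R) :
  ball x e%:C y = (rnorm (x - y) < e).
Proof. by rewrite -ball_normE /ball_/= rnormE ltcR. Qed.

Section cauchy_limit.
Variables (F : set_system (ell1 T V)).
Hypotheses (PF : ProperFilter F) (Fc : cauchy F).

Let Fball (e : R) : 0 < e -> exists z, F (ball z e%:C).
Proof. by move=> e0; apply: (cauchyP F).1 => //; rewrite ltcR. Qed.

Let eval (t : T) (x : ell1 T V) : V := x t.

Let eval_cvg t : cvg (eval t @ F).
Proof.
apply: cauchy_cvg; apply: cauchy_exP => e /gt0_complexE[-> e0].
have [z Fz] := Fball e0.
exists (z t); rewrite /= /nbhs/=; apply: filterS Fz => x /=.
rewrite !ball_rnorm; apply: le_lt_trans.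
by rewrite -ell1NE -ell1DE rnorm_le_ell1.
Qed.

Let g t : V := lim (eval t @ F).

Let ball_g z (e : R) (A : {fset T}) :
  F (ball z e%:C) -> \sum_(t <- A) rnorm (z t - g t) <= e.
Proof.
move=> Fz; apply/ler_addgt0Pr => d d0.
pose d' := d / (#|` A|.+1)%:R.
have d'0 : 0 < d' by rewrite divr_gt0.
have : F (\bigcap_(t in [set` A]) [set y : ell1 T V | rnorm (y t - g t) < d']).
  apply: filter_bigI => t tA.
  have cg : eval t @ F --> g t by exact: eval_cvg.
  have d'C0 : 0 < d'%:C by rewrite ltcR.
  have /cvgrPdist_lt/(_ _ d'C0) := cg; apply: filterS => y /=.
  by rewrite rnormE ltcR rnormB.
move=> /(filterI Fz)/filter_ex[y []]; rewrite ball_rnorm rnorm_ell1 => zy yg.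
apply: (@le_trans _ _ (\sum_(t <- A) (rnorm ((z - y) t) + d'))).
  rewrite big_seq [leRHS]big_seq; apply: ler_sum => t tA.
  rewrite -(subrKA (y t)) (le_trans (rnormD _ _))// ell1DE ell1NE lerD2l.
  exact/ltW/yg.
rewrite big_split/= lerD//.
  exact: le_trans (le_ell1_norm (z - y) A) (ltW zy).
rewrite big_const_seq count_predT iter_addr addr0 -[leLHS]mulr_natr /d' mulrAC.
by rewrite ler_pdivrMr// ler_wpM2l ?ltW// ltr_nat.
Qed.

Let g_ell1 : g \in @ell1_pred R T V.
Proof.
have [z Fz] := Fball ltr01.
rewrite -[g](subKr (ell1_fun z)) rpredB//; first by case: (z).
by apply/ell1_predP; exists 1 => A; exact: ball_g.
Qed.

Lemma ell1_cauchy_cvg : cvg F.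
Proof.
apply/cvg_ex; exists (Ell1 g_ell1); apply/cvgrPdist_lt => e /gt0_complexE[-> e0].
have e20 : 0 < complex.Re e / 2 by rewrite divr_gt0.
have [z Fz] := Fball e20; near=> x.
rewrite rnormE ltcR -(subrKA z) (le_lt_trans (rnormD _ _))//.
rewrite [ltRHS]splitr ler_ltD//.
  by rewrite rnormB rnorm_ell1; apply/ell1_norm_leP => A; exact: ball_g.
by rewrite -ball_rnorm; near: x.
Unshelve. all: by end_near. Qed.

End cauchy_limit.

HB.instance Definition _ :=
  Uniform_isComplete.Build (ell1 T V) ell1_cauchy_cvg.

End ell1_complete.

#[export] Existing Instance summability.totally_filter.

Section bsum.
Context {R : realType} {T : choiceType} {V : completeNormedModType R[i]}.
Implicit Types (f : T -> V) (x y : ell1 T V) (A B : {fset T}).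
Local Notation partial_sum := summability.partial_sum.
Local Notation totally := summability.totally.

Lemma partial_sumE f A : partial_sum f A = \sum_(t <- A) f t.
Proof. by rewrite /partial_sum big_seq_fsetE. Qed.

Lemma rnorm_sum {W : normedModType R[i]} (f : T -> W) (s : seq T) (P : pred T) :
  rnorm (\sum_(t <- s | P t) f t) <= \sum_(t <- s | P t) rnorm (f t).
Proof.
elim/big_ind2 : _ => [|u a v b ua vb|//]; first by rewrite rnorm0.
by rewrite (le_trans (rnormD _ _))// lerD.
Qed.

Lemma sum_fset_split (Z : nmodType) (F : T -> Z) A B : (A `<=` B)%fset ->
  \sum_(t <- B) F t = \sum_(t <- A) F t + \sum_(t <- B | t \notin A) F t.
Proof.
move=> AB; rewrite (bigID (mem A))/= big_fset_condE; congr (_ + _).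
by apply: eq_fbigl => t; rewrite !inE/= andb_idl//; exact: (fsubsetP AB).
Qed.

Lemma ell1_tail x (e : R) : 0 < e -> exists A, forall B, (A `<=` B)%fset ->
  \sum_(t <- B | t \notin A) rnorm (x t) <= e.
Proof.
move=> e0; apply: contrapT => /forallNP H.
have : ell1_norm x <= ell1_norm x - e.
  apply/ell1_norm_leP => A; have /existsNP[B /not_implyP[AB /negP]] := H A.
  rewrite -ltNge => eB; rewrite lerBrDr.
  rewrite (le_trans _ (le_ell1_norm x B))//.
  by rewrite (sum_fset_split _ AB) lerD2l ltW.
by rewrite lerBrDr gerDl leNgt e0.
Qed.

(* The sum of an absolutely summable family is the limit of its finite partial
   sums; outside [ell1] the value is irrelevant. *)
Definition bsum f : V := summability.sum f.

Lemma bsum_cvg x : partial_sum x @ totally --> bsum x.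
Proof.
suff : cvg (partial_sum x @ totally) by [].
apply: cauchy_cvg; apply: cauchy_exP => e /gt0_complexE[-> e0].
have e20 : 0 < complex.Re e / 2 by rewrite divr_gt0.
have [A xA] := ell1_tail x e20.
exists (partial_sum x A); exists A => // B /= AB; rewrite ball_rnorm rnormB.
have -> : partial_sum x B - partial_sum x A = \sum_(t <- B | t \notin A) x t.
  by rewrite !partial_sumE (sum_fset_split _ AB) addrAC subrr add0r.
rewrite (le_lt_trans (rnorm_sum _ _ _))// (le_lt_trans (xA B AB))//.
by rewrite ltr_pdivrMr// ltr_pMr// ltr1n.
Qed.

Lemma bsum_unique x (v : V) : partial_sum x @ totally --> v -> bsum x = v.
Proof. by move=> xv; exact: cvg_lim. Qed.

Lemma bsum_finite f A : (forall t, t \notin A -> f t = 0) ->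
  bsum f = \sum_(t <- A) f t.
Proof.
move=> fA; apply: cvg_lim => //; apply: (@cvg_near_cst _ _ _ _ totally).
exists A => // B AB /=; rewrite partial_sumE (sum_fset_split _ AB).
by rewrite [X in _ + X]big1 ?addr0.
Qed.

Lemma bsumP (k : R[i]) x y : bsum (k *: x + y) = k *: bsum x + bsum y.
Proof.
apply: bsum_unique.
have -> : partial_sum (k *: x + y) = k *: partial_sum x + partial_sum y.
  apply/funext => A; rewrite !fctE !partial_sumE scaler_sumr -big_split.
  by apply: eq_bigr.
by apply: cvgD; [apply: cvgZr|]; exact: bsum_cvg.
Qed.

Lemma bsum_approx x (A : {fset T}) (e : R) : 0 < e ->
  exists2 B, (A `<=` B)%fset & rnorm (bsum x - \sum_(t <- B) x t) < e.
Proof.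
move=> e0; have eC0 : 0 < e%:C :> R[i] by rewrite ltcR.
have /cvgrPdist_lt/(_ _ eC0)[B _ /= xB] := @bsum_cvg x.
exists (A `|` B)%fset; first exact: fsubsetUl.
by rewrite -partial_sumE -ltcR -rnormE; apply: xB; exact: fsubsetUr.
Qed.

Definition delta_fun (t : T) (v : V) (s : T) : V := if s == t then v else 0.

Let delta_ell1 t v : delta_fun t v \in @ell1_pred R T V.
Proof.
apply/ell1_predP; exists (rnorm v) => A.
rewrite (eq_bigr (fun s => if s == t then rnorm v else 0)); last first.
  by move=> s _; rewrite /delta_fun; case: ifP => // _; rewrite rnorm0.
rewrite -big_mkcond/= big_const_seq iter_addr addr0 count_uniq_mem ?fset_uniq//.
by case: (t \in A); rewrite ?mulr0n ?rnorm_ge0.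
Qed.

Definition delta t v : ell1 T V := Ell1 (delta_ell1 t v).

Lemma sum_deltaE x A s :
  (\sum_(t <- A) delta t (x t)) s = if s \in A then x s else 0.
Proof.
have -> : (\sum_(t <- A) delta t (x t)) s = \sum_(t <- A) delta t (x t) s.
  by elim/big_ind2 : _ => // u a v b ua vb; rewrite ell1DE ua vb.
rewrite /= /delta_fun; case: ifPn => sA.
  rewrite (big_fsetD1 s)//= eqxx big_seq big1 ?addr0// => t.
  by rewrite !inE => /andP[/negPf]; rewrite eq_sym => ->.
by rewrite big_seq big1// => t tA; case: eqP => // st; rewrite st tA in sA.
Qed.

Lemma ell1_density {W : normedModType R[i]} (F G : bounded_op (ell1 T V) W) :
  (forall t v, F (delta t v) = G (delta t v)) -> F = G.
Proof.
move=> FG; apply/bounded_opP => x.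
have [M M0 FGM] := bounded_op_bound (F - G).
apply/eqP; rewrite -subr_eq0; apply/eqP/rnorm0_eq0/le_anti.
rewrite rnorm_ge0 andbT; apply/ler_addgt0Pr => e e0; rewrite add0r.
have e1 : 0 < e / (M + 1) by rewrite divr_gt0// ltr_wpDl.
have [A xA] := ell1_tail x e1.
pose y := x - \sum_(t <- A) delta t (x t).
have yA : rnorm y <= e / (M + 1).
  apply/ell1_norm_leP => B; rewrite (le_trans _ (xA (A `|` B)%fset _)) ?fsubsetUl//.
  rewrite [leRHS]big_mkcond/=.
  apply: (@le_trans _ _ (\sum_(t <- (A `|` B)%fset) rnorm (y t))).
    rewrite (sum_fset_split _ (fsubsetUr A B)) lerDl sumr_ge0// => t _.
    exact: rnorm_ge0.
  apply: ler_sum => t _; rewrite /y ell1DE ell1NE sum_deltaE.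
  by case: ifPn => tA; rewrite ?subrr ?subr0 ?rnorm0// ?tA.
have -> : F x - G x = (F - G) y.
  have E : F (\sum_(t <- A) delta t (x t)) = G (\sum_(t <- A) delta t (x t)).
    by rewrite !linear_sum; apply: eq_bigr => t _; exact: FG.
  by rewrite bounded_opDE bounded_opNE /y (linearB F) (linearB G)/= E opprB addrA subrK.
rewrite (le_trans (FGM y))// (@le_trans _ _ (M * (e / (M + 1))))//.
  by rewrite ler_wpM2l.
rewrite mulrCA ger_pMr// ler_pdivrMr ?mul1r ?lerDl//.
by rewrite ltr_wpDl.
Qed.

End bsum.

Section bounded_op_comp.
Context {R : realType} {U V W : normedModType R[i]}.
Variables (g : bounded_op V W) (f : bounded_op U V).

Let comp_linear : linear (fun x => g (f x)).
Proof. by move=> k x y; rewrite !linearP. Qed.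

Let comp_bound x : rnorm (g (f x)) <= (opnorm g * opnorm f) * rnorm x.
Proof.
by rewrite (le_trans (opnorm_bound _ _))// -mulrA ler_wpM2l ?opnorm_ge0 ?opnorm_bound.
Qed.

Definition bounded_op_comp : bounded_op U W :=
  make_bounded_op comp_linear comp_bound.

End bounded_op_comp.

Lemma ler_sum_subseq {R : realType} {Z : eqType} (u : Z -> R) (s t : seq Z) :
  (forall z, 0 <= u z) -> uniq s -> uniq t -> {subset s <= t} ->
  \sum_(z <- s) u z <= \sum_(z <- t) u z.
Proof.
move=> u0 us ut st.
have -> : \sum_(z <- s) u z = \sum_(z <- [seq z <- t | z \in s]) u z.
  apply: perm_big; apply: uniq_perm => //; first exact: filter_uniq.
  by move=> z; rewrite mem_filter andb_idr//; exact: st.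
by rewrite big_filter big_mkcond/=; apply: ler_sum => z _; case: ifP.
Qed.

Section munn_product.
Context {R : realType} {A : banachAlgType R[i]} {I J : choiceType}.
Variable P : J -> I -> A.
Implicit Types X Y Z : ell1 (I * J)%type A.

Definition supnorm : \bar R :=
  ereal_sup [set (rnorm (P ji.1 ji.2))%:E | ji in [set: J * I]].

(* The terms of the [(i, l)] entry of the matrix product [X P Y]. *)
Definition munn_terms (X Y : I * J -> A) (il : I * J) (jk : J * I) : A :=
  bmul (bmul (X (il.1, jk.1)) (P jk.1 jk.2)) (Y (jk.2, il.2)).

Definition munn_mul (X Y : I * J -> A) (il : I * J) : A := bsum (munn_terms X Y il).

Definition LM of (supnorm <= 1)%E : Type := ell1 (I * J)%type A.

Hypothesis P1 : (supnorm <= 1)%E.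

Let rnormP j i : rnorm (P j i) <= 1.
Proof.
rewrite -lee_fin; apply: le_trans P1.
by apply: ereal_sup_ubound; exists (j, i).
Qed.

Let terms_le X Y il jk : rnorm (munn_terms X Y il jk) <=
  rnorm (X (il.1, jk.1)) * rnorm (Y (jk.2, il.2)).
Proof.
rewrite (le_trans (rnorm_bmul _ _))// ler_wpM2r ?rnorm_ge0//.
rewrite (le_trans (rnorm_bmul _ _))// -[leRHS]mulr1.
by rewrite ler_wpM2l ?rnorm_ge0.
Qed.

Let sum_terms_le X Y (F : {fset I * J}) (G : {fset J * I}) :
  \sum_(il <- F) \sum_(jk <- G) rnorm (munn_terms X Y il jk) <= rnorm X * rnorm Y.
Proof.
pose u (z : (I * J) * (I * J)) := rnorm (X z.1) * rnorm (Y z.2).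
pose h (il : I * J) (jk : J * I) := ((il.1, jk.1), (jk.2, il.2)).
pose SX := [fset (il.1, jk.1) | il in F, jk in G]%fset.
pose SY := [fset (jk.2, il.2) | il in F, jk in G]%fset.
apply: (@le_trans _ _ (\sum_(z <- [seq h il jk | il <- F, jk <- G]) u z)).
  rewrite big_allpairs_dep; apply: ler_sum => il _; apply: ler_sum => jk _.
  exact: terms_le.
apply: (@le_trans _ _ (\sum_(z <- [seq (a, b) | a <- SX, b <- SY]) u z)).
  apply: ler_sum_subseq.
  - by move=> z; rewrite mulr_ge0 ?rnorm_ge0.
  - apply: allpairs_uniq; rewrite ?fset_uniq//.
    by move=> [[? ?] [? ?]] [[? ?] [? ?]] _ _ /= [-> -> -> ->].
  - apply: allpairs_uniq; rewrite ?fset_uniq//.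
    by move=> [? ?] [? ?] _ _ /= [-> ->].
  - move=> _ /allpairsP[[il jk]/= [ilF jkG ->]]; apply/allpairsP.
    exists ((il.1, jk.1), (jk.2, il.2)); split => //=.
    + by apply/imfset2P; exists il => //; exists jk.
    + by apply/imfset2P; exists il => //; exists jk.
rewrite big_allpairs /u/=.
under eq_bigr do rewrite -mulr_sumr; rewrite -mulr_suml.
by rewrite ler_pM ?sumr_ge0 ?le_ell1_norm// => t _; exact: rnorm_ge0.
Qed.

Let terms_ell1 X Y il : munn_terms X Y il \in @ell1_pred R (J * I)%type A.
Proof.
apply/ell1_predP; exists (rnorm X * rnorm Y) => G.
by have := sum_terms_le X Y [fset il]%fset G; rewrite big_seq_fset1.
Qed.

Let sum_mul_le X Y (F : {fset I * J}) :
  \sum_(il <- F) rnorm (munn_mul X Y il) <= rnorm X * rnorm Y.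
Proof.
apply/ler_addgt0Pr => e e0.
pose e' := e / (#|` F|.+1)%:R.
have e'0 : 0 < e' by rewrite divr_gt0.
have e'C0 : 0 < e'%:C :> R[i] by rewrite ltcR.
have /filter_ex[G GF] : summability.totally (\bigcap_(il in [set` F])
    [set G | rnorm (munn_mul X Y il - \sum_(jk <- G) munn_terms X Y il jk) < e']).
  apply: filter_bigI => il ilF.
  have /cvgrPdist_lt/(_ _ e'C0) := @bsum_cvg _ _ _ (Ell1 (terms_ell1 X Y il)).
  by apply: filterS => G /=; rewrite rnormE ltcR partial_sumE.
apply: (@le_trans _ _ (\sum_(il <- F)
    (\sum_(jk <- G) rnorm (munn_terms X Y il jk) + e'))).
  rewrite big_seq [leRHS]big_seq; apply: ler_sum => il ilF.
  rewrite -(subrK (\sum_(jk <- G) munn_terms X Y il jk) (munn_mul X Y il)).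
  rewrite (le_trans (rnormD _ _))// addrC lerD//; first exact: rnorm_sum.
  exact/ltW/GF.
rewrite big_split/= lerD ?sum_terms_le//.
rewrite big_const_seq count_predT iter_addr addr0 -[leLHS]mulr_natr /e' mulrAC.
by rewrite ler_pdivrMr// ler_wpM2l ?ltW// ltr_nat.
Qed.

Let munn_ell1 X Y : munn_mul X Y \in @ell1_pred R (I * J)%type A.
Proof. by apply/ell1_predP; exists (rnorm X * rnorm Y); exact: sum_mul_le. Qed.

Definition munn X Y : ell1 (I * J)%type A := Ell1 (munn_ell1 X Y).

Lemma rnorm_munn X Y : rnorm (munn X Y) <= rnorm X * rnorm Y.
Proof. by apply/ell1_norm_leP; exact: sum_mul_le. Qed.

Lemma munn_linearl Y : linear (munn^~ Y).
Proof.
move=> k X X'; apply/ell1P => il; rewrite ell1DE ell1ZE.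
rewrite -[RHS](bsumP k (Ell1 (terms_ell1 X Y il)) (Ell1 (terms_ell1 X' Y il))).
congr bsum; apply/funext => jk.
rewrite -[RHS]/(k *: munn_terms X Y il jk + munn_terms X' Y il jk).
by rewrite /munn_terms ell1DE ell1ZE !bmulDl !bmulZl.
Qed.

Lemma munn_linearr X : linear (munn X).
Proof.
move=> k Y Y'; apply/ell1P => il; rewrite ell1DE ell1ZE.
rewrite -[RHS](bsumP k (Ell1 (terms_ell1 X Y il)) (Ell1 (terms_ell1 X Y' il))).
congr bsum; apply/funext => jk.
rewrite -[RHS]/(k *: munn_terms X Y il jk + munn_terms X Y' il jk).
by rewrite /munn_terms ell1DE ell1ZE !bmulDr !bmulZr.
Qed.

Let munnl_bound Y X : rnorm (munn X Y) <= rnorm Y * rnorm X.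
Proof. by rewrite mulrC rnorm_munn. Qed.

Let munnl Y := make_bounded_op (munn_linearl Y) (munnl_bound Y).

Let munnr X := make_bounded_op (munn_linearr X) (rnorm_munn X).

Lemma munn_delta i j k l (a b : A) :
  munn (delta (i, j) a) (delta (k, l) b) = delta (i, l) (bmul (bmul a (P j k)) b).
Proof.
have b0 (c : A) : bmul 0 c = 0 by rewrite -(scale0r (0 : A)) bmulZl !scale0r.
have b0' (c : A) : bmul c 0 = 0 by rewrite -(scale0r (0 : A)) bmulZr !scale0r.
apply/ell1P => -[i' l'] /=; rewrite /munn_mul.
rewrite (@bsum_finite _ _ _ _ [fset (j, k)]%fset); last first.
  move=> [j' k']; rewrite inE xpair_eqE negb_and /munn_terms/= /delta_fun !xpair_eqE.
  by move=> /orP[]/negPf ->; rewrite ?andbF ?b0 ?b0'.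
rewrite big_seq_fset1 /munn_terms/= /delta_fun !xpair_eqE !eqxx andbT/=.
by case: (i' == i); case: (l' == l); rewrite ?b0 ?b0'.
Qed.

Lemma munnA : associative munn.
Proof.
have XX Y Z : (forall t a, munn (delta t a) (munn Y Z) = munn (munn (delta t a) Y) Z) ->
    forall X, munn X (munn Y Z) = munn (munn X Y) Z.
  move=> H X; apply: (congr1 (fun f : bounded_op _ _ => f X)
    (@ell1_density _ _ _ _ (munnl (munn Y Z)) (bounded_op_comp (munnl Z) (munnl Y)) H)).
have YY X Z : (forall t a, munn X (munn (delta t a) Z) = munn (munn X (delta t a)) Z) ->
    forall Y, munn X (munn Y Z) = munn (munn X Y) Z.
  move=> H Y; apply: (congr1 (fun f : bounded_op _ _ => f Y)
    (@ell1_density _ _ _ _ (bounded_op_comp (munnr X) (munnl Z))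
      (bounded_op_comp (munnl Z) (munnr X)) H)).
have ZZ X Y : (forall t a, munn X (munn Y (delta t a)) = munn (munn X Y) (delta t a)) ->
    forall Z, munn X (munn Y Z) = munn (munn X Y) Z.
  move=> H Z; apply: (congr1 (fun f : bounded_op _ _ => f Z)
    (@ell1_density _ _ _ _ (bounded_op_comp (munnr X) (munnr Y))
      (munnr (munn X Y)) H)).
move=> X Y Z; apply: XX => -[i j] a; apply: YY => -[k l] b; apply: ZZ => -[m n] c.
by rewrite !munn_delta !bmulA.
Qed.

Lemma munnDl : left_distributive munn +%R.
Proof. by move=> X Y Z; exact: (linearD (munnl Z)). Qed.

Lemma munnDr : right_distributive munn +%R.
Proof. by move=> X Y Z; exact: (linearD (munnr X)). Qed.

Lemma munnZl (k : R[i]) X Y : munn (k *: X) Y = k *: munn X Y.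
Proof. by rewrite -[LHS]/(munnl Y (k *: X)) linearZ. Qed.

Lemma munnZr (k : R[i]) X Y : munn X (k *: Y) = k *: munn X Y.
Proof. by rewrite -[LHS]/(munnr X (k *: Y)) linearZ. Qed.

Lemma norm_munn X Y : `|munn X Y| <= `|X| * `|Y|.
Proof. by rewrite !rnormE -(rmorphM (real_complex R)) lecR rnorm_munn. Qed.

HB.instance Definition _ := CompleteNormedModule.on (LM P1).
HB.instance Definition _ := CompleteNormedModule_isBanachAlgebra.Build R[i] (LM P1)
  munnA munnDl munnDr munnZl munnZr norm_munn.

End munn_product.

Arguments LM {R A I J} P _.

(* Main.v *)
Require Import Defs.
From HB Require Import structures.
From mathcomp Require Import all_boot all_order all_algebra finmap.
From mathcomp Require Import all_classical reals ereal topology normedtype.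
From mathcomp.real_closed Require Import complex.
From mathcomp Require Import ring.
Import Order.TTheory GRing.Theory Num.Theory.
Import numFieldNormedType.Exports.

Set Implicit Arguments.
Unset Strict Implicit.
Unset Printing Implicit Defensive.

Local Open Scope classical_set_scope.
Local Open Scope ring_scope.
Local Open Scope complex_scope.

(** Write [p = P j0 i0] for one invertible entry, [q] for its inverse, and
    [E i j a] for the matrix whose only entry is [a], at [(i, j)], so that
    [E i j a o E k l b = E i l (a P_jk b)].

    Since [p q = 1], the map [a |-> E i0 j0 (q a)] is a homomorphism from [A]
    into the Munn algebra (the corner).  A cyclic derivation [D] of the Munn
    algebra pulls back along it to a cyclic derivation [D'] of [A], for which the
    hypothesis provides functionals [x_l] on [A].

    The corner determines [D] up to an inner derivation.  Regard [D] as the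
    antisymmetric form [D x y], so that the derivation rule reads
    [D (x y) z = D x (y z) + D y (z x)].  Factoring
    [E i j a = E i j0 (a q) o E i0 j 1], and then factoring the product of the
    second factor with [E k l c] through the corner, one gets
    [[
      D (E i j a) (E k l c) = f (E k l c o E i j a) - f (E i j a o E k l c)
                              - D' (p P_jk c q) (p P_li a q),
      where f (E i j a) = D (E i0 j 1) (E i j0 (a q)).
    ]]
    The first two terms are those of [ad f].  Moreover
    [a |-> p P_ji a q], applied to the entry at [(i, j)], turns both products
    [E k l c o E i j a] and [E i j a o E k l c] into products in [A] of
    [p P_jk c q] and [p P_li a q]; hence the functional
    [g_l (E i j a) = x_l (p P_ji a q)] contributes
    [- ad x_l (p P_jk c q) (p P_li a q)] to [ad (f + g_l)].  Therefore
    [ad (f + g_l)] differs from [D] on elementary matrices by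
    [(D' - ad x_l) (p P_jk c q) (p P_li a q)], which tends to [0]
    ([ad_munn_functional]).

    What remains is analysis on [ell1].  Bounded functionals on elementary
    matrices sum up to a functional on the whole algebra ([ell1_lift]), the
    operators [ad (f + g_l)] are uniformly bounded because they are so on
    elementary matrices ([opnorm_ell1_le]), and for a bounded net convergence on
    elementary matrices implies convergence everywhere ([ell1_antisym_cvg]). *)

(** * Completeness of the complex numbers *)

Section complex_complete.
Context {R : realType}.
Implicit Types z w : R[i]^o.

Lemma ler_norm_Re z : `|complex.Re z| <= rnorm z.
Proof.
case: z => a b; rewrite /rnorm normc_def/= -sqrtr_sqr ler_wsqrtr// lerDl.
exact: sqr_ge0.
Qed.

Lemma ler_norm_Im z : `|complex.Im z| <= rnorm z.
Proof.
case: z => a b; rewrite /rnorm normc_def/= -sqrtr_sqr ler_wsqrtr// lerDr.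
exact: sqr_ge0.
Qed.

Lemma rnorm_le_ReIm z : rnorm z <= `|complex.Re z| + `|complex.Im z|.
Proof.
case: z => a b; rewrite /rnorm normc_def/=.
rewrite -[leRHS]ger0_norm ?addr_ge0// -[leRHS]sqrtr_sqr ler_wsqrtr//.
rewrite sqrrD !real_normK ?num_real// lerD2r lerDl mulrn_wge0//.
Qed.

Lemma complex_cauchy_cvg (F : set_system R[i]^o) :
  ProperFilter F -> cauchy F -> cvg F.
Proof.
move=> PF Fc.
have coord (p : R[i]^o -> R) : (forall z w, p (z - w) = p z - p w) ->
    (forall z, `|p z| <= rnorm z) -> cvg (p @ F).
  move=> pB p_le; apply: cauchy_cvg; apply: cauchy_exP => e e0.
  have eC0 : 0 < e%:C :> R[i] by rewrite ltcR.
  have [z Fz] := (cauchyP F).1 Fc _ eC0.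
  exists (p z); rewrite /= /nbhs/=; apply: filterS Fz => w /=.
  rewrite ball_rnorm -ball_normE /ball_/= -pB; exact: le_lt_trans.
have /cvg_ex[a Fa] : cvg (@complex.Re R @ F).
  by apply: coord => [[? ?] [? ?]|] //; exact: ler_norm_Re.
have /cvg_ex[b Fb] : cvg (@complex.Im R @ F).
  by apply: coord => [[? ?] [? ?]|] //; exact: ler_norm_Im.
apply/cvg_ex; exists ((a +i* b) : R[i]^o).
apply/cvgrPdist_lt => e /gt0_complexE[-> e0].
have e20 : 0 < complex.Re e / 2 by rewrite divr_gt0.
have /cvgrPdist_lt/(_ _ e20) Fa' := Fa.
have /cvgrPdist_lt/(_ _ e20) Fb' := Fb.
near=> w; rewrite rnormE ltcR (le_lt_trans (rnorm_le_ReIm _))//.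
have -> : complex.Re ((a +i* b) - w) = a - complex.Re w by case: (w).
have -> : complex.Im ((a +i* b) - w) = b - complex.Im w by case: (w).
by rewrite [ltRHS]splitr ltrD//; near: w.
Unshelve. all: by end_near. Qed.

(** A packed structure rather than a canonical instance: the regular module
    [_^o] already has a completeness instance, for a real scalar field, and a
    second one with the same key would never be found.  The underlying normed
    module is convertible to [R[i]^o]. *)
Definition complex_complete_module : completeNormedModType R[i] :=
  HB.pack R[i]^o (Uniform_isComplete.Build R[i]^o complex_cauchy_cvg).

End complex_complete.

Arguments complex_complete_module R : clear implicits.

(** * Operators on ell1 are controlled by elementary families *)

Section ell1_operators.
Context {R : realType} {T : choiceType} {V : completeNormedModType R[i]}.

Lemma rnorm_delta (t : T) (v : V) : rnorm (delta t v) <= rnorm v.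
Proof.
apply/ell1_norm_leP => A; rewrite /= /delta_fun.
rewrite (eq_bigr (fun s => if s == t then rnorm v else 0)); last first.
  by move=> s _; case: ifP => // _; rewrite rnorm0.
rewrite -big_mkcond/= big_const_seq iter_addr addr0 count_uniq_mem ?fset_uniq//.
by case: (t \in A); rewrite ?mulr0n ?rnorm_ge0.
Qed.

Lemma delta_linear (t : T) : linear (@delta R T V t).
Proof.
move=> k u v; apply/ell1P => s; rewrite ell1DE ell1ZE /= /delta_fun.
by case: ifP => _ //; rewrite scaler0 addr0.
Qed.

Let delta_bound (t : T) (v : V) : rnorm (delta t v) <= 1 * rnorm v.
Proof. by rewrite mul1r rnorm_delta. Qed.

Definition delta_op (t : T) : bounded_op V (ell1 T V) :=
  make_bounded_op (delta_linear t) (delta_bound t).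

Lemma ell1_approx (x : ell1 T V) (e : R) : 0 < e ->
  exists A : {fset T}, rnorm (x - \sum_(t <- A) delta t (x t)) <= e.
Proof.
move=> e0; have [A xA] := ell1_tail x e0; exists A.
set y := x - _; apply/ell1_norm_leP => B.
rewrite (le_trans _ (xA (A `|` B)%fset _)) ?fsubsetUl//.
rewrite [leRHS]big_mkcond/=.
apply: (@le_trans _ _ (\sum_(t <- (A `|` B)%fset) rnorm (y t))).
  rewrite (sum_fset_split _ (fsubsetUr A B)) lerDl sumr_ge0// => t _.
  exact: rnorm_ge0.
apply: ler_sum => t _; rewrite /y ell1DE ell1NE sum_deltaE.
by case: ifPn => tA; rewrite ?subrr ?subr0 ?rnorm0// ?tA.
Qed.

Context {W : normedModType R[i]}.

(** The norm of [ell1] is the sum of the norms of the terms [delta t (x t)], so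
    it is the largest norm for which every [delta t] is a contraction; a bound
    on these families therefore carries over to their closed span. *)
Lemma opnorm_ell1_le (F : bounded_op (ell1 T V) W) (M : R) : 0 <= M ->
  (forall t v, rnorm (F (delta t v)) <= M * rnorm v) -> opnorm F <= M.
Proof.
move=> M0 FM; apply: opnorm_le => // x; apply/ler_addgt0Pr => e e0.
have e1 : 0 < e / (opnorm F + 1) by rewrite divr_gt0// ltr_wpDl// opnorm_ge0.
have [A xA] := ell1_approx x e1; set y := \sum_(t <- A) _ in xA.
rewrite -(subrK y x) linearD (le_trans (rnormD _ _))// addrC lerD//.
  rewrite subrK /y linear_sum (le_trans (rnorm_sum _ _ _))//.
  apply: (@le_trans _ _ (\sum_(t <- A) M * rnorm (x t))).
    by apply: ler_sum => t _; exact: FM.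
  by rewrite -mulr_sumr ler_wpM2l// le_ell1_norm.
rewrite (le_trans (opnorm_bound _ _))//.
rewrite (@le_trans _ _ (opnorm F * (e / (opnorm F + 1))))//.
  by rewrite ler_wpM2l ?opnorm_ge0.
rewrite mulrCA ger_pMr// ler_pdivrMr ?mul1r ?lerDl//.
by rewrite ltr_wpDl ?opnorm_ge0.
Qed.

(** The uniform bound [M] absorbs the error made by replacing [x] by a finite
    combination of elementary families. *)
Lemma ell1_bounded_cvg (L : Type) (Fl : set_system L) (PF : ProperFilter Fl)
    (G : L -> bounded_op (ell1 T V) W) (G0 : bounded_op (ell1 T V) W) (M : R) :
  (forall l, opnorm (G l) <= M) ->
  (forall t v, (fun l => G l (delta t v)) @ Fl --> G0 (delta t v)) ->
  forall x, (fun l => G l x) @ Fl --> G0 x.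
Proof.
move=> GM Gd x; apply/cvgrPdist_lt => e /gt0_complexE[-> e0].
set r := complex.Re e in e0 *.
have r20 : 0 < r / 2 by rewrite divr_gt0.
have r2C0 : 0 < (r / 2)%:C :> R[i] by rewrite ltcR.
(* The added 1 makes [N] positive; [`|M|] spares a proof that [M] is. *)
pose N := opnorm G0 + `|M| + 1.
have N0 : 0 < N by rewrite ltr_wpDl// addr_ge0 ?opnorm_ge0.
have d0 : 0 < r / 2 / N by rewrite divr_gt0.
have [A xA] := ell1_approx x d0; set y := \sum_(t <- A) _ in xA.
have Gy : (fun l => G l y) @ Fl --> G0 y.
  rewrite /y linear_sum; under eq_fun do rewrite linear_sum.
  by apply: cvg_big => [|t _]; [exact: add_continuous|exact: Gd].
have /cvgrPdist_lt/(_ _ r2C0) := Gy; apply: filterS => l.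
rewrite !rnormE !ltcR => Gly.
have -> : G0 x - G l x = (G0 y - G l y) + (G0 - G l) (x - y).
  rewrite bounded_opDE bounded_opNE (linearB G0) (linearB (G l))/=.
  by rewrite opprB addrACA subrKC addKr.
rewrite (le_lt_trans (rnormD _ _))// [ltRHS]splitr ltr_leD//.
rewrite (le_trans (opnorm_bound _ _))//.
have GN : opnorm (G0 - G l) <= N.
  rewrite -rnorm_opnorm (le_trans (rnormD _ _))// ler_wpDr// lerD//.
  by rewrite /rnorm normrN (le_trans (GM l))// ler_norm.
rewrite (le_trans (ler_pM _ _ GN xA)) ?opnorm_ge0 ?rnorm_ge0//.
by rewrite mulrC divfK// gt_eqF.
Qed.

End ell1_operators.

Section ell1_lift.
Context {R : realType} {T : choiceType} {V W : completeNormedModType R[i]}.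

Lemma rnorm_bsum (x : ell1 T W) : rnorm (bsum x) <= rnorm x.
Proof.
apply/ler_addgt0Pr => e e0.
have [B _ xB] := bsum_approx x fset0 e0.
rewrite -(subrK (\sum_(t <- B) x t) (bsum x)) (le_trans (rnormD _ _))//.
rewrite addrC lerD//; last exact: ltW.
by rewrite (le_trans (rnorm_sum _ _ _))// le_ell1_norm.
Qed.

Variables (F : T -> bounded_op V W) (M : R).
Hypothesis M0 : 0 <= M.
Hypothesis FM : forall t v, rnorm (F t v) <= M * rnorm v.

Let sum_le (x : ell1 T V) (A : {fset T}) :
  \sum_(t <- A) rnorm (F t (x t)) <= M * rnorm x.
Proof.
apply: (@le_trans _ _ (\sum_(t <- A) M * rnorm (x t))); first exact: ler_sum.
by rewrite -mulr_sumr ler_wpM2l// le_ell1_norm.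
Qed.

Let terms_ell1 (x : ell1 T V) : (fun t => F t (x t)) \in @ell1_pred R T W.
Proof. by apply/ell1_predP; exists (M * rnorm x) => A; exact: sum_le. Qed.

Let lift_linear : linear (fun x : ell1 T V => bsum (fun t => F t (x t))).
Proof.
move=> k x y; rewrite -[RHS](bsumP k (Ell1 (terms_ell1 x)) (Ell1 (terms_ell1 y))).
by congr bsum; apply/funext => t; rewrite ell1DE ell1ZE linearP.
Qed.

Let lift_bound (x : ell1 T V) : rnorm (bsum (fun t => F t (x t))) <= M * rnorm x.
Proof.
rewrite (le_trans (rnorm_bsum (Ell1 (terms_ell1 x))))//.
by apply/ell1_norm_leP => A; exact: sum_le.
Qed.

(** The universal property of [ell1] as a coproduct: a uniformly bounded family of
    operators on the coordinates extends to the whole space. *)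
Definition ell1_lift : bounded_op (ell1 T V) W :=
  make_bounded_op lift_linear lift_bound.

Lemma ell1_lift_delta t v : ell1_lift (delta t v) = F t v.
Proof.
rewrite /= (@bsum_finite _ _ _ _ [fset t]%fset) => [|s].
  by rewrite big_seq_fset1 /= /delta_fun eqxx.
by rewrite inE /= /delta_fun => /negPf ->; rewrite linear0.
Qed.

End ell1_lift.

(** * Derivations into the dual as bilinear forms *)

Section derivations.
Context {R : realType}.

Lemma derivation_cocycle {B : banachAlgType R[i]} (D : bounded_op B (dual B)) :
  is_derivation D ->
  forall x y z, D (bmul x y) z = D x (bmul y z) + D y (bmul z x).
Proof. by move=> dD x y z; rewrite dD. Qed.

Lemma cyclic_antisym {B : banachAlgType R[i]} (D : bounded_op B (dual B)) :
  is_cyclic D -> forall x y, D x y = - D y x.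
Proof. by move=> cD x y; apply/eqP; rewrite -addr_eq0 cD. Qed.

Lemma adE {B : banachAlgType R[i]} (f : dual B) x y :
  ad f x y = f (bmul y x) - f (bmul x y).
Proof. by []. Qed.

Lemma bilinear_bound {V W : normedModType R[i]} (F : bounded_op V (dual W)) v w :
  rnorm (F v w : R[i]^o) <= opnorm F * rnorm v * rnorm w.
Proof.
rewrite (le_trans (opnorm_bound _ _))// ler_wpM2r ?rnorm_ge0//.
by rewrite -rnorm_opnorm opnorm_bound.
Qed.

(** Convergence on pairs of elementary families is extended one variable at a
    time; antisymmetry brings the variable being extended to the second place,
    where the form is a functional. *)
Lemma ell1_antisym_cvg (T : choiceType) (V : completeNormedModType R[i])
    (L : Type) (Fl : set_system L) (PF : ProperFilter Fl)
    (G : L -> bounded_op (ell1 T V) (dual (ell1 T V)))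
    (G0 : bounded_op (ell1 T V) (dual (ell1 T V))) (M : R) :
  (forall l, opnorm (G l) <= M) ->
  (forall l x y, G l x y = - G l y x) -> (forall x y, G0 x y = - G0 y x) ->
  (forall s t v w, (fun l => G l (delta s v) (delta t w)) @ Fl -->
    G0 (delta s v) (delta t w)) ->
  forall x y, (fun l => G l x y) @ Fl --> G0 x y.
Proof.
move=> GM Ganti G0anti Gdelta x y.
have bound z l : opnorm (G l z) <= M * rnorm z.
  by rewrite -rnorm_opnorm (le_trans (opnorm_bound _ _))// ler_wpM2r ?rnorm_ge0.
apply: (@ell1_bounded_cvg R T V R[i]^o _ _ _ (fun l => G l x) _ _ (bound x)) => t w.
rewrite G0anti; under eq_fun do rewrite Ganti.
apply: cvgN.
apply: (@ell1_bounded_cvg R T V R[i]^o _ _ _ (fun l => G l (delta t w)) _ _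
  (bound _)) => s v.
exact: Gdelta.
Qed.

Section pullback.
Context {A B : banachAlgType R[i]} (theta : bounded_op A B).
Hypothesis thetaM : {morph theta : a b / bmul a b >-> bmul a b}.
Variable D : bounded_op B (dual B).

Let pb_linear : linear (fun a => bounded_op_comp (D (theta a)) theta).
Proof.
by move=> k a b; apply/bounded_opP => c; rewrite /= linearP linearP.
Qed.

Let pb_bound a : rnorm (bounded_op_comp (D (theta a)) theta) <=
  (opnorm D * opnorm theta * opnorm theta) * rnorm a.
Proof.
apply: opnorm_le => [|b]; first by rewrite !mulr_ge0 ?opnorm_ge0 ?rnorm_ge0.
rewrite (le_trans (bilinear_bound _ _ _))// -!mulrA ler_wpM2l ?opnorm_ge0//.
rewrite [X in _ <= X](_ : _ =
  (opnorm theta * rnorm a) * (opnorm theta * rnorm b)); last first.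
  by rewrite !mulrA [_ * rnorm a]mulrAC.
by rewrite ler_pM ?rnorm_ge0 ?opnorm_bound.
Qed.

Definition pullback : bounded_op A (dual A) := make_bounded_op pb_linear pb_bound.

Lemma pullback_derivation : is_derivation D -> is_derivation pullback.
Proof.
move=> dD a b; apply/bounded_opP => c.
by rewrite bounded_opDE /= !thetaM derivation_cocycle.
Qed.

Lemma pullback_cyclic : is_cyclic D -> is_cyclic pullback.
Proof. by move=> cD a b; exact: cD. Qed.

End pullback.

Section sandwich.
Context {A : banachAlgType R[i]} (a b : A).

Let sw_linear : linear (fun x => bmul (bmul a x) b).
Proof. by move=> k x y; rewrite bmulDr bmulDl bmulZr bmulZl. Qed.

Let sw_bound x : rnorm (bmul (bmul a x) b) <= (rnorm a * rnorm b) * rnorm x.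
Proof.
rewrite (le_trans (rnorm_bmul _ _))// [leRHS]mulrAC ler_wpM2r ?rnorm_ge0//.
exact: rnorm_bmul.
Qed.

Definition sandwich : bounded_op A A := make_bounded_op sw_linear sw_bound.

Lemma rnorm_sandwich x : rnorm (sandwich x) <= (rnorm a * rnorm b) * rnorm x.
Proof. exact: sw_bound. Qed.

End sandwich.

End derivations.

(** * Reduction of the Munn algebra to a corner *)

Section munn.
Context {R : realType} {A : unitalBanachAlgType R[i]} {I J : choiceType}.
Context {P : J -> I -> A} (P1 : (supnorm P <= 1)%E).
Variables (j0 : J) (i0 : I) (q : A).
Local Notation p := (P j0 i0).
Local Notation B := (LM P P1).
Hypotheses (pq : bmul p q = bone) (qp : bmul q p = bone).

Lemma rnorm_entry_le1 j i : rnorm (P j i) <= 1.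
Proof.
rewrite -lee_fin; apply: le_trans P1.
by apply: ereal_sup_ubound; exists (j, i).
Qed.

Definition munn_elem i j (a : A) : B := delta (i, j) a.
Local Notation E := munn_elem.

Lemma munn_elemM i j k l a b :
  bmul (E i j a) (E k l b) = E i l (bmul (bmul a (P j k)) b).
Proof. exact: munn_delta. Qed.

(** [a |-> E i0 j0 (q a)], the copy of [A] in the Munn algebra; the factor [q]
    cancels the entry [p] that the product inserts. *)
Definition corner : bounded_op A B :=
  bounded_op_comp (delta_op (i0, j0)) (sandwich q bone).

Lemma cornerE a : corner a = E i0 j0 (bmul q a).
Proof. by rewrite -[corner a]/(E i0 j0 _) /= bmul1r. Qed.

Lemma cornerM : {morph corner : a b / bmul a b >-> bmul a b}.
Proof.
move=> a b; rewrite !cornerE munn_elemM; congr E.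
by rewrite -!bmulA (bmulA p) pq bmul1l.
Qed.

Section decomposition.
Variable D : bounded_op B (dual B).
Hypotheses (dD : is_derivation D) (cD : is_cyclic D).

(** The product of [E i j a] and [E k l b] has the entry [a P_jk b] at [(i, l)],
    and [twist l i (a P_jk b)] is the product of [twist l i a] and [twist j k b]:
    each factor is twisted by the entry of [P] that precedes it in the cyclic
    word [P_li a P_jk b].  As this rule is symmetric under cyclic rotation, it
    applies to both products in a commutator with the same two twists. *)
Definition twist j i : bounded_op A A := sandwich (bmul p (P j i)) q.

Lemma twistE j i a : twist j i a = bmul (bmul (bmul p (P j i)) a) q.
Proof. by []. Qed.

Lemma rnorm_twist j i a : rnorm (twist j i a) <= rnorm p * rnorm q * rnorm a.
Proof.
rewrite (le_trans (rnorm_sandwich _ _ _))// ler_wpM2r ?rnorm_ge0//.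
rewrite ler_wpM2r ?rnorm_ge0// (le_trans (rnorm_bmul _ _))//.
by rewrite -[leRHS]mulr1 ler_wpM2l ?rnorm_ge0// rnorm_entry_le1.
Qed.

(** Up to the inner derivation of [E i j a |-> D (E i0 j 1) (E i j0 (a q))], the
    form [D] is the pullback to the corner.  The reason is that
    [E i j a = E i j0 (a q) o E i0 j 1] and
    [E i0 j 1 o E k l c = corner (p P_jk c q) o E i0 l 1]: the cocycle identity is
    used once for each factorization, with antisymmetry in between. *)
Lemma munn_decomposition i j k l a c :
  D (E i j a) (E k l c) =
    D (E i0 j bone) (E k j0 (bmul (bmul (bmul c (P l i)) a) q))
    - D (E i0 l bone) (E i j0 (bmul (bmul (bmul a (P j k)) c) q))
    - pullback corner D (twist j k c) (twist l i a).
Proof.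
pose x := E i j0 (bmul a q); pose z := E k l c.
have -> : E i j a = bmul x (E i0 j bone).
  by rewrite munn_elemM bmul1r -bmulA qp bmul1r.
rewrite derivation_cocycle//.
have -> : bmul z x = E k j0 (bmul (bmul (bmul c (P l i)) a) q).
  by rewrite munn_elemM bmulA.
rewrite addrC -addrA; congr (_ + _).
have -> : bmul (E i0 j bone) z = bmul (corner (twist j k c)) (E i0 l bone).
  rewrite cornerE !munn_elemM bmul1l bmul1r; congr E.
  by rewrite twistE !bmulA qp bmul1l -(bmulA _ q) qp bmul1r.
rewrite cyclic_antisym// derivation_cocycle// opprD addrC.
congr (- D _ _ - D _ _); rewrite cornerE munn_elemM twistE; congr E.
  by rewrite !bmulA qp !bmul1l.
by rewrite -!bmulA !(bmulA q p) qp !bmul1l.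
Qed.

Section lift.
Variable x : dual A.

Let term (t : I * J) : bounded_op A R[i]^o :=
  bounded_op_comp (D (E i0 t.2 bone))
    (bounded_op_comp (delta_op (t.1, j0)) (sandwich bone q))
  + bounded_op_comp x (twist t.2 t.1).

Let M := opnorm D * rnorm (bone : A) * (rnorm (bone : A) * rnorm q)
  + opnorm x * (rnorm p * rnorm q).

Let M0 : 0 <= M.
Proof. by rewrite addr_ge0 ?mulr_ge0 ?opnorm_ge0 ?rnorm_ge0. Qed.

Let term_bound t a : rnorm (term t a) <= M * rnorm a.
Proof.
rewrite (le_trans (rnormD _ _))// mulrDl lerD//.
  rewrite (le_trans (bilinear_bound _ _ _))// -[leRHS]mulrA ler_pM//.
  - by rewrite mulr_ge0 ?opnorm_ge0 ?rnorm_ge0.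
  - exact: rnorm_ge0.
  - by rewrite ler_wpM2l ?opnorm_ge0// rnorm_delta.
  - by rewrite (le_trans (rnorm_delta _ _))// rnorm_sandwich.
rewrite /= (le_trans (opnorm_bound x _))// -[leRHS]mulrA ler_wpM2l ?opnorm_ge0//.
exact: rnorm_twist.
Qed.

(** The functional [f + g] with [f (E i j a) = D (E i0 j 1) (E i j0 (a q))] and
    [g (E i j a) = x (p P_ji a q)]: the first part accounts for the inner part
    of [D], the second one transports [x] from [A] to the Munn algebra. *)
Definition munn_functional : dual B :=
  @ell1_lift R (I * J)%type A (complex_complete_module R) term M M0 term_bound.

Lemma munn_functionalE i j a : munn_functional (E i j a) =
  D (E i0 j bone) (E i j0 (bmul a q)) + x (twist j i a).
Proof.
rewrite [LHS](@ell1_lift_delta R (I * J)%type A (complex_complete_module R)).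
by rewrite /term /= fctE bmul1l.
Qed.

(** This is what turns an approximation on [A] into one on the Munn algebra:
    the error of [munn_functional] on elementary matrices is the error of [x] on
    [A] at the twisted arguments. *)
Lemma ad_munn_functional i j k l a c :
  ad munn_functional (E i j a) (E k l c) = D (E i j a) (E k l c)
    + (pullback corner D - ad x) (twist j k c) (twist l i a).
Proof.
rewrite adE !munn_elemM !munn_functionalE (munn_decomposition i j k l a c).
rewrite bounded_opDE bounded_opNE.
(* The factor [q p = 1] between two twists turns the product of [A] into that
   of the Munn algebra. *)
have twistM u v s t b d : bmul (twist u v b) (twist s t d) =
    twist u v (bmul (bmul b (P s t)) d).
  by rewrite !twistE -!bmulA (bmulA q p) qp bmul1l.
rewrite -[(_ - ad x _) _]/(pullback corner D (twist j k c) (twist l i a)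
   - ad x (twist j k c) (twist l i a)) [ad x _ _]adE !twistM.
by rewrite subrKA opprB opprD addrACA.
Qed.

Lemma opnorm_ad_munn_functional (N : R) : opnorm (ad x) <= N ->
  opnorm (ad munn_functional) <= opnorm D
    + (opnorm (pullback corner D) + N) * (rnorm p * rnorm q) * (rnorm p * rnorm q).
Proof.
move=> xN; set r := rnorm p * rnorm q; set K := leRHS.
have r0 : 0 <= r by rewrite mulr_ge0 ?rnorm_ge0.
have N0 : 0 <= N by rewrite (le_trans _ xN)// opnorm_ge0.
have K0 : 0 <= K.
  rewrite /K; apply: addr_ge0; first exact: opnorm_ge0.
  apply: mulr_ge0 => //; apply: mulr_ge0 => //.
  by apply: addr_ge0 => //; exact: opnorm_ge0.
apply: (@opnorm_ell1_le R (I * J)%type A (dual B)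
  (ad munn_functional) K K0) => -[i j] a.
apply: (@opnorm_ell1_le R (I * J)%type A R[i]^o
  (ad munn_functional (E i j a))) => [|[k l] c].
  by rewrite mulr_ge0 ?rnorm_ge0.
rewrite -/(E i j a) -/(E k l c) ad_munn_functional.
rewrite (le_trans (rnormD _ _))// !mulrDl lerD//.
  rewrite (le_trans (bilinear_bound _ _ _))//.
  rewrite ler_pM ?mulr_ge0 ?opnorm_ge0 ?rnorm_ge0 ?rnorm_delta//.
  by rewrite ler_wpM2l ?opnorm_ge0// rnorm_delta.
rewrite (le_trans (bilinear_bound _ _ _))//.
have pxN : opnorm (pullback corner D - ad x) <= opnorm (pullback corner D) + N.
  rewrite -rnorm_opnorm (le_trans (rnormD _ _))// lerD//.
  by rewrite /rnorm normrN.
have -> : opnorm (pullback corner D) * r * r * rnorm a * rnorm c +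
    N * r * r * rnorm a * rnorm c =
    (opnorm (pullback corner D) + N) * (r * rnorm c) * (r * rnorm a) by ring.
rewrite ler_pM ?mulr_ge0 ?opnorm_ge0 ?rnorm_ge0 ?rnorm_twist//.
by rewrite ler_pM ?opnorm_ge0 ?rnorm_ge0 ?rnorm_twist.
Qed.

End lift.
End decomposition.
End munn.

(* [P_nonzero] is part of the usual definition of a Munn algebra and cannot be
   dropped: for P = 0 the product of LM(A, P) is zero, so every ad_x is zero,
   while any antisymmetric bounded bilinear form is a cyclic derivation. *)
Theorem theorem3p6 (R : realType) (A : unitalBanachAlgType R[i])
  (I J : choiceType) (P : J -> I -> A)
  (P_nonzero : exists j i, P j i <> 0)
  (P_invertible : forall j i, P j i <> 0 -> binvertible (P j i))
  (P_le1 : (supnorm P <= 1)%E) :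
  bounded_wstar_approx_cyclic_amenable A ->
  bounded_wstar_approx_cyclic_amenable (LM P P_le1).
Proof.
move=> amenA D dD cD.
have [j0 [i0 /P_invertible[q [pq qp]]]] := P_nonzero.
have thetaM := cornerM P_le1 pq.
have [L [le [x [dir [M xM] xD]]]] := amenA _
  (@pullback_derivation _ _ _ _ thetaM _ dD) (@pullback_cyclic _ _ _ _ _ cD).
pose f l := munn_functional j0 i0 q D (x l).
have adf l := ad_munn_functional qp dD cD (x l).
have PF := tails_filter dir.
have fK l := opnorm_ad_munn_functional qp dD cD (xM l).
exists L, le, f; split => //; first by eexists; exact: fK.
apply: (@ell1_antisym_cvg _ (I * J)%type A _ _ PF (fun l => ad (f l)) D _ fK).
- by move=> l y z; rewrite !adE opprB.
- exact: (cyclic_antisym cD).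
move=> [i j] [k m] a c; under eq_fun do rewrite adf.
set c' := twist j0 i0 q j k c; set a' := twist j0 i0 q m i a.
set Dac := D _ _; set b := pullback (corner P_le1 j0 i0 q) D c' a'.
suff : (fun l => Dac + (b - ad (x l) c' a')) @ tails le --> Dac + (b - b).
  by rewrite subrr addr0.
by apply: cvgD; [exact: cvg_cst|apply: cvgB; [exact: cvg_cst|exact: xD]].
Qed.
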